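(* Let $\widehat{\mathbb{Z}}=\mathrm{Hom}(\mathbb{Z},U(1))\cong\mathbb{R}/\mathbb{Z}$ be the Pontryagin dual of the discrete group $\mathbb{Z}$. The spatial wavenumber factor $\mathcal{G}_{\mathrm{wave}}$ of the wave closure space $\mathcal{G}$ is canonically isomorphic to the torsion subgroup of $\widehat{\mathbb{Z}}$: $$\mathcal{G}_{\mathrm{wave}}\cong\mathrm{Torsion}(\widehat{\mathbb{Z}})=\mathbb{Q}/\mathbb{Z}\subset\mathbb{R}/\mathbb{Z}.$$ Moreover, under the Euclidean quotient metric on $\mathbb{R}/\mathbb{Z}$, $\mathcal{G}_{\mathrm{wave}}$ (identified with its image) is a dense, countable subgroup of $\mathbb{R}/\mathbb{Z}$ (the first Brillouin zone).
   Context: Here $\widehat{\mathbb{Z}}$ denotes the Pontryagin dual (not the profinite integers); the identification $\mathbb{R}/\mathbb{Z}\to\widehat{\mathbb{Z}}$ sends $k$ to the character $\chi_k(m)=e^{2\pi i km}$. The wave closure space $\mathcal{G}$ is defined as follows. For $\theta:\mathbb{Z}\to\mathbb{R}$ put $\pi(\theta)[m]=\exp(2\pi i\theta[m])$. Let $C$ be the smallest set of functions $\mathbb{Z}\to\mathbb{R}$ containing $\Theta_Z[m]=m$ and $\Theta_{\bar 1}[m]=1$ and closed under pointwise addition, negation, and, for all integers $n\ge1$ and $k\in\{0,\dots,n-1\}$, the root operations $\theta\mapsto(\theta+k)/n$. Then $\mathcal{G}=\pi(C)$, a group under pointwise multiplication, isomorphic to $(\mathbb{Q}/\mathbb{Z})\times(\mathbb{Q}/\mathbb{Z})$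 via $([\alpha],[\beta])\mapsto\bigl(m\mapsto\exp(2\pi i(\alpha m+\beta))\bigr)$. The spatial wavenumber factor $\mathcal{G}_{\mathrm{wave}}$ is the first factor, i.e. the subgroup of sequences $m\mapsto\exp(2\pi i\alpha m)$ with $\alpha\in\mathbb{Q}/\mathbb{Z}$. *)

(* Defs.v *)
From HB Require Import structures.
From mathcomp Require Import all_boot all_order all_algebra.
From mathcomp Require Import generic_quotient ring_quotient.
From mathcomp Require Import complex.
From mathcomp Require Import all_classical all_reals all_analysis.
From mathcomp Require Import ring.
Set Implicit Arguments.
Unset Strict Implicit.
Unset Printing Implicit Defensive.
Import Order.TTheory GRing.Theory Num.Theory.
Local Open Scope classical_set_scope.
Local Open Scope ring_scope.
Local Open Scope quotient_scope.
Local Open Scope complex_scope.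

Record circle (R : realType) := Circle {
  circle_val :> R[i];
  circle_valP : `|circle_val| == 1 }.

HB.instance Definition _ (R : realType) := [isSub for @circle_val R].
HB.instance Definition _ (R : realType) := [Choice of circle R by <:].

Section CircleGroup.
Variable R : realType.
Implicit Types z w : circle R.

Fact circle1_proof : `|1 : R[i]| == 1.
Proof. by rewrite normr1. Qed.

Fact circleM_proof z w : `|circle_val z * circle_val w| == 1.
Proof. by rewrite normrM (eqP (circle_valP z)) (eqP (circle_valP w)) mulr1. Qed.

Fact circleV_proof z : `|(circle_val z)^-1| == 1.
Proof. by rewrite normfV (eqP (circle_valP z)) invr1. Qed.

Definition circle_one : circle R := Circle circle1_proof.
Definition circle_mul z w : circle R := Circle (circleM_proof z w).
Definition circle_inv z : circle R := Circle (circleV_proof z).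

Fact circle_mulA : associative circle_mul.
Proof. by move=> x y z; apply: val_inj; rewrite /= mulrA. Qed.

Fact circle_mul1 : left_id circle_one circle_mul.
Proof. by move=> x; apply: val_inj; rewrite /= mul1r. Qed.

Fact circle_mulr1 : right_id circle_one circle_mul.
Proof. by move=> x; apply: val_inj; rewrite /= mulr1. Qed.

Fact circle_val_neq0 z : circle_val z != 0.
Proof. by rewrite -normr_eq0 (eqP (circle_valP z)) oner_eq0. Qed.

Fact circle_mulV : left_inverse circle_one circle_inv circle_mul.
Proof. by move=> x; apply: val_inj; rewrite /= mulVf // circle_val_neq0. Qed.

Fact circle_mulrV : right_inverse circle_one circle_inv circle_mul.
Proof. by move=> x; apply: val_inj; rewrite /= mulfV // circle_val_neq0. Qed.

HB.instance Definition _ := isGroup.Build (circle R)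
  circle_mulA circle_mul1 circle_mulr1 circle_mulV circle_mulrV.

Lemma circle_mulC z w : (z * w = w * z)%g.
Proof. by apply: val_inj; rewrite /= mulrC. Qed.

Fact cis_proof (x : R) : `|cos (2 * pi * x) +i* sin (2 * pi * x)| == 1.
Proof. by rewrite normc_def /= cos2Dsin2 sqrtr1. Qed.

(* [cis x] is e^{2 pi i x}, by Euler's formula. *)
Definition cis (x : R) : circle R := Circle (cis_proof x).

Lemma cisD x y : cis (x + y) = (cis x * cis y)%g.
Proof.
by apply: val_inj; rewrite /= mulrDr cosD sinD; simpc; rewrite [X in _ +i* X]addrC.
Qed.

Lemma cis0 : cis 0 = 1%g.
Proof. by apply: val_inj; rewrite /= mulr0 cos0 sin0. Qed.

Lemma cisN x : cis (- x) = (cis x)^-1%g.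
Proof. by apply: (mulIg (cis x)); rewrite -cisD addNr cis0 mulVg. Qed.

Lemma cisDn x n : cis (x + n%:R) = cis x.
Proof.
have e : 2 * pi * (x + n%:R) = 2 * pi * x + (pi *+ 2) *+ n :> R.
  by rewrite mulrDr mulr_natr mulr_natl.
by apply: val_inj; rewrite /= e !(periodicn (@cosD2pi R)) !(periodicn (@sinD2pi R)).
Qed.

Lemma cisDz x (k : int) : cis (x + k%:~R) = cis x.
Proof.
case: k => n; first exact: cisDn.
by rewrite NegzE mulrNz -[LHS](cisDn _ n.+1) subrK.
Qed.

End CircleGroup.

Definition useq (R : realType) := int -> circle R.

Section UseqGroup.
Variable R : realType.
Implicit Types f g : useq R.

HB.instance Definition _ := Choice.on (useq R).

Definition useq_one : useq R := fun=> 1%g.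
Definition useq_mul f g : useq R := fun m => (f m * g m)%g.
Definition useq_inv f : useq R := fun m => (f m)^-1%g.

Fact useq_mulA : associative useq_mul.
Proof. by move=> f g h; apply/funext => m; exact: mulgA. Qed.

Fact useq_mul1 : left_id useq_one useq_mul.
Proof. by move=> f; apply/funext => m; exact: mul1g. Qed.

Fact useq_mulr1 : right_id useq_one useq_mul.
Proof. by move=> f; apply/funext => m; exact: mulg1. Qed.

Fact useq_mulV : left_inverse useq_one useq_inv useq_mul.
Proof. by move=> f; apply/funext => m; exact: mulVg. Qed.

Fact useq_mulrV : right_inverse useq_one useq_inv useq_mul.
Proof. by move=> f; apply/funext => m; exact: mulgV. Qed.

HB.instance Definition _ := isGroup.Build (useq R)
  useq_mulA useq_mul1 useq_mulr1 useq_mulV useq_mulrV.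

End UseqGroup.

Definition is_character (R : realType) : set (useq R) :=
  [set chi | forall m n : int, chi (m + n) = (chi m * chi n)%g].

Definition dualZ (R : realType) := set_type (@is_character R).

Definition torsion (A : groupType) : set A :=
  [set x : A | exists2 n : nat, (0 < n)%N & (x ^+ n = 1)%g].
Arguments torsion : clear implicits.

Section DualGroup.
Variable R : realType.

HB.instance Definition _ := SubChoice.on (dualZ R).

Fact is_character_group_closed :
  group_closed (fun f : useq R => f \in @is_character R).
Proof.
split; first by apply/mem_set => m n; rewrite mulg1.
move=> f g /set_mem fP /set_mem gP; apply/mem_set => m n.
change ((f (m + n) * (g (m + n))^-1)%g
  = ((f m * (g m)^-1) * (f n * (g n)^-1))%g).
by rewrite fP gP invgM (circle_mulC (g n)^-1%g) -!mulgA; congr (_ * _)%g;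
  rewrite !mulgA; congr (_ * _)%g; exact: circle_mulC.
Qed.

HB.instance Definition _ :=
  SubChoice_isSubGroup.Build _ _ (dualZ R) is_character_group_closed.

Lemma dualZ_mulC (x y : dualZ R) : (x * y = y * x)%g.
Proof. by apply: val_inj; apply/funext => m; exact: circle_mulC. Qed.

(* Torsion elements form a subgroup because the dual is abelian. *)
Definition torsionZ := set_type (torsion (dualZ R)).

HB.instance Definition _ := SubChoice.on torsionZ.

Fact torsionZ_group_closed :
  group_closed (fun x : dualZ R => x \in torsion (dualZ R)).
Proof.
split; first by apply/mem_set; exists 1%N.
move=> x y /set_mem[n n0 xn] /set_mem[p p0 yp]; apply/mem_set.
exists (n * p)%N; first by rewrite muln_gt0 n0.
rewrite expgMn; last exact: dualZ_mulC.
by rewrite expgnA xn expg1n mul1g expVgn mulnC expgnA yp expg1n invg1.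
Qed.

HB.instance Definition _ :=
  SubChoice_isSubGroup.Build _ _ torsionZ torsionZ_group_closed.

End DualGroup.

(* [phase_closure], [phase_proj] and [wave_space] are the C, pi and G = pi(C) of
   the wave closure construction. *)
Inductive phase_closure (R : realType) : (int -> R) -> Prop :=
| phase_id : phase_closure (fun m => m%:~R)
| phase_one : phase_closure (fun=> 1)
| phase_add theta1 theta2 : phase_closure theta1 -> phase_closure theta2 ->
    phase_closure (fun m => theta1 m + theta2 m)
| phase_opp theta : phase_closure theta ->
    phase_closure (fun m => - theta m)
| phase_root theta (n k : nat) : (1 <= n)%N -> (k < n)%N ->
    phase_closure theta -> phase_closure (fun m => (theta m + k%:R) / n%:R).

Definition phase_proj (R : realType) (theta : int -> R) : useq R :=
  fun m => cis (theta m).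

Definition wave_space (R : realType) : set (useq R) :=
  @phase_proj R @` @phase_closure R.

(* The sequence m |-> e^{2 pi i alpha m} depends only on alpha modulo Z, so the
   sequences indexed by alpha in Q/Z are those indexed by rational alpha. *)
Definition spatial_wave (R : realType) (alpha : rat) : useq R :=
  fun m => cis (ratr alpha * m%:~R).

Definition wave_factor (R : realType) : set (useq R) :=
  [set f | @wave_space R f /\ exists alpha, f = spatial_wave R alpha].

Definition Gwave (R : realType) := set_type (@wave_factor R).

Section WaveGroup.
Variable R : realType.

HB.instance Definition _ := SubChoice.on (Gwave R).

Fact wave_factor_group_closed :
  group_closed (fun f : useq R => f \in @wave_factor R).
Proof.
split.
  apply/mem_set; split.
    exists (fun m => 1 + - 1); first exact: phase_add (phase_one _) (phase_opp (phase_one _)).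
    by apply/funext => m; rewrite /phase_proj subrr cis0.
  by exists 0; apply/funext => m; rewrite /spatial_wave rmorph0 mul0r cis0.
move=> f g /set_mem[[t tP tf] [a fa]] /set_mem[[u uP ug] [b gb]].
apply/mem_set; split.
  exists (fun m => t m + - u m); first exact: phase_add tP (phase_opp uP).
  by rewrite -tf -ug; apply/funext => m; rewrite /phase_proj cisD cisN.
exists (a - b); rewrite fa gb; apply/funext => m.
by rewrite /spatial_wave rmorphB mulrBl cisD cisN.
Qed.

HB.instance Definition _ :=
  SubChoice_isSubGroup.Build _ _ (Gwave R) wave_factor_group_closed.

End WaveGroup.

Definition integers (R : realType) : {pred R} := [pred x | x \is a Num.int].

Fact integers_zmod_closed (R : realType) : zmod_closed (@integers R).
Proof. by split=> [|a b]; rewrite !inE ?rpred0 //; exact: rpredB. Qed.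

HB.instance Definition _ (R : realType) :=
  GRing.isZmodClosed.Build R (@integers R) (@integers_zmod_closed R).

Definition RmodZ (R : realType) := @Quotient.quot R (@integers R).

Section RmodZMetric.
Variable R : realType.
Implicit Types (a b c : R) (x y z : RmodZ R).

HB.instance Definition _ := GRing.Zmodule.on (RmodZ R).

Lemma RmodZ_eqP a b :
  \pi_(RmodZ R) a = \pi_(RmodZ R) b <-> a - b \is a Num.int.
Proof.
have e : (a - b \is a Num.int) = (a == b %[mod RmodZ R]).
  exact: (Quotient.idealrBE (@integers R) a b).
by split=> [/eqP|h]; [rewrite -e|apply/eqP; rewrite -e].
Qed.

Definition RmodZ_dist x y : R :=
  inf [set `|a - b| | a in [set a | \pi_(RmodZ R) a = x]
                    & b in [set b | \pi_(RmodZ R) b = y]].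

Lemma RmodZ_dist_le a b :
  RmodZ_dist (\pi_(RmodZ R) a) (\pi_(RmodZ R) b) <= `|a - b|.
Proof.
apply: ge_inf; last by exists a => //; exists b.
by exists 0 => _ [c _ [d _ <-]].
Qed.

Lemma RmodZ_dist_lt x y e : RmodZ_dist x y < e ->
  exists a b, [/\ \pi_(RmodZ R) a = x, \pi_(RmodZ R) b = y & `|a - b| < e].
Proof.
move=> /inf_lt[].
  by exists `|repr x - repr y|; exists (repr x); rewrite /= ?reprK //;
    exists (repr y); rewrite /= ?reprK.
by move=> _ [a ax [b bx <-]] ?; exists a, b.
Qed.

Lemma RmodZ_dist_ge0 x y : 0 <= RmodZ_dist x y.
Proof.
rewrite leNgt; apply/negP => /RmodZ_dist_lt[a [b [_ _]]].
by rewrite normr_lt0.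
Qed.

Fact RmodZ_distxx x : RmodZ_dist x x = 0.
Proof.
apply/eqP; rewrite eq_le RmodZ_dist_ge0 andbT -[x]reprK.
by rewrite (le_trans (RmodZ_dist_le _ _)) // subrr normr0.
Qed.

Fact RmodZ_dist_eq0 x y : RmodZ_dist x y = 0 -> x = y.
Proof.
rewrite -[x]reprK -[y]reprK => d0; apply/RmodZ_eqP; apply: contrapT => /negP.
set c := repr x - repr y; rewrite intrEfloor => cN.
have c1 : 0 < c - (Num.floor c)%:~R.
  by rewrite subr_gt0 lt_neqAle cN floor_le.
have c2 : 0 < (Num.floor c + 1)%:~R - c by rewrite subr_gt0 floorD1_gt.
have [a [b []]] : exists a b, [/\ \pi_(RmodZ R) a = \pi_(RmodZ R) (repr x),
    \pi_(RmodZ R) b = \pi_(RmodZ R) (repr y) &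
    `|a - b| < Num.min (c - (Num.floor c)%:~R) ((Num.floor c + 1)%:~R - c)].
  by apply: RmodZ_dist_lt; rewrite d0 lt_min c1.
move=> /RmodZ_eqP/intrP[p ap] /RmodZ_eqP/intrP[q bq].
have -> : a - b = c - (q - p)%:~R.
  by rewrite rmorphB/= -ap -bq /c; ring.
rewrite lt_min => /andP[]; rewrite !ltr_norml => /andP[_ h1] /andP[h2 _].
have [le|lt] := leP (q - p) (Num.floor c).
  by move: h1; rewrite ltrD2l ltrN2 ltr_int ltNge le.
move: h2; rewrite opprB ltrD2l ltrN2 ltr_int => h2.
by move: lt; rewrite -lezD1 leNgt h2.
Qed.

Fact RmodZ_dist_sym x y : RmodZ_dist x y = RmodZ_dist y x.
Proof.
congr inf; apply/seteqP; split=> _ [a ax [b bx <-]];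
  by exists b => //; exists a => //; rewrite distrC.
Qed.

Fact RmodZ_dist_triangle y x z :
  RmodZ_dist x z <= RmodZ_dist x y + RmodZ_dist y z.
Proof.
apply/ler_addgt0Pl => e e0; rewrite addrC (splitr e) addrACA.
have lt t : t < t + e / 2 by rewrite ltrDl divr_gt0.
have [a [b [<- <- ab]]] := RmodZ_dist_lt (lt (RmodZ_dist x y)).
have [b' [c [bb' <- bc]]] := RmodZ_dist_lt (lt (RmodZ_dist (\pi b) z)).
have ac : \pi_(RmodZ R) a = \pi_(RmodZ R) (a + (b' - b)).
  by apply/esym/RmodZ_eqP; rewrite addrC addKr; apply/RmodZ_eqP.
have := RmodZ_dist_le (a + (b' - b)) c; rewrite -ac => /le_trans; apply.
have -> : a + (b' - b) - c = (a - b) + (b' - c) by ring.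
by apply: (le_trans (ler_normD _ _)); rewrite ltW // ltrD.
Qed.

HB.instance Definition _ := isMetric.Build R (RmodZ R)
  RmodZ_distxx RmodZ_dist_eq0 RmodZ_dist_sym RmodZ_dist_triangle.

Lemma RmodZ_mdistE x y : mdist x y = RmodZ_dist x y.
Proof. by []. Qed.

Definition QmodZ : set (RmodZ R) :=
  [set \pi_(RmodZ R) (ratr q) | q in [set: rat]].

Fact char_proof x :
  (fun m : int => cis (repr x * m%:~R)) \in @is_character R.
Proof. by apply/mem_set => m n; rewrite rmorphD mulrDr cisD. Qed.

(* The character m |-> e^{2 pi i k m} of the class of k; it does not depend on
   the representative k, see [char_ofE]. *)
Definition char_of x : dualZ R := SigSub (char_proof x).

Lemma char_ofE (k : R) (m : int) :
  val (char_of (\pi_(RmodZ R) k)) m = cis (k * m%:~R).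
Proof.
rewrite /char_of /=.
have /RmodZ_eqP/intrP[p kp] : \pi_(RmodZ R) (repr (\pi_(RmodZ R) k)) = \pi_(RmodZ R) k.
  by rewrite reprK.
rewrite -[repr _](subrK k) kp mulrDl addrC -rmorphM; exact: cisDz.
Qed.

End RmodZMetric.

(* Main.v *)
Require Import Defs.
From HB Require Import structures.
From mathcomp Require Import all_boot all_order all_algebra.
From mathcomp Require Import generic_quotient complex.
From mathcomp Require Import all_classical all_reals all_analysis.
From mathcomp Require Import ring lra.
Import Order.TTheory GRing.Theory Num.Theory.
Local Open Scope classical_set_scope.
Local Open Scope ring_scope.

(** A character of the integers is determined by its value at 1, an arbitrary
    point e^{2 pi i k} of the unit circle, and k matters only modulo integers.
    Hence k |-> (m |-> e^{2 pi i k m}) is an isomorphism from R/Z onto the dual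
    ([char_ofD], [char_of_bij]). The facts about the exponential behind this are
    that its kernel is the group of integers ([cis_eq1]) and that it is onto the
    circle ([cis_surj]).

    An n-th power of the character of k is trivial iff n k is an integer, so the
    torsion characters are those with rational wavenumber ([torsion_char_of]).
    The wave factor is this same set of sequences ([wave_factorE]): sums and
    negation give all integral slopes, and the roots divide them by any positive
    integer. The isomorphism from the wave factor to the torsion subgroup is thus
    the identity on underlying sequences ([wave_to_torsion]), and its range
    pulled back to R/Z is Q/Z, which is dense and countable because the rationals
    are dense in the reals and countable. *)

(** After subtracting the floor one may take 0 <= y < 1; then the duplication
    formula turns cos (2 pi y) = 1 into sin (pi y) = 0, which forces y = 0
    because the sine is positive on the open interval from 0 to pi. *)
Lemma cis_eq1 (R : realType) (x : R) : cis x = 1%g <-> x \is a Num.int.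
Proof.
split=> [|/intrP[k ->]]; last by rewrite -[k%:~R]add0r cisDz cis0.
set y := x - (Num.floor x)%:~R.
have y0 : 0 <= y by rewrite subr_ge0 floor_le.
have y1 : y < 1 by rewrite ltrBlDl; have := floorD1_gt x; rewrite intrD.
have -> : cis x = cis y by rewrite -(subrK (Num.floor x)%:~R x) cisDz.
move=> /(congr1 (@circle_val R)) /= [c1 _].
rewrite (_ : 2 * pi * y = (pi * y) *+ 2) ?cos_mulr2n in c1; last by ring.
have cs := cos2Dsin2 (pi * y).
have /eqP : sin (pi * y) ^+ 2 = 0 by lra.
rewrite sqrf_eq0 => s0.
have [y00|yN0] := eqVneq y 0.
  by move/eqP: y00; rewrite subr_eq0 => /eqP ->; exact: intr_int.
have : 0 < sin (pi * y).
  by apply: sin_gt0_pi; rewrite gtr_pMr ?pi_gt0 // y1 mulr_gt0 ?pi_gt0 // lt_def yN0.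
by rewrite (eqP s0) ltxx.
Qed.

Lemma cis_eq (R : realType) (x y : R) : cis x = cis y <-> x - y \is a Num.int.
Proof.
rewrite -cis_eq1 cisD cisN; split=> [->|e]; first exact: mulgV.
by rewrite -[RHS]mul1g -e -mulgA mulVg mulg1.
Qed.

(** The angle of a + ib is acos a when b >= 0 and - acos a otherwise, since the
    sine of acos a is |b| on the unit circle. *)
Lemma cis_surj {R : realType} (z : circle R) : exists x, cis x = z.
Proof.
case: z => -[a b] zP.
have ab1 : a ^+ 2 + b ^+ 2 = 1.
  move: (zP); rewrite normc_def /= => /eqP[s1].
  rewrite -(@sqr_sqrtr _ (a ^+ 2 + b ^+ 2)) ?addr_ge0 ?sqr_ge0 //.
  by rewrite s1 expr1n.
have aI : -1 <= a <= 1 by have := sqr_ge0 b; nra.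
have ca : cos (acos a) = a by apply: acosK; rewrite in_itv.
have sa : sin (acos a) = `|b|.
  by rewrite sin_acos // -sqrtr_sqr -ab1 addrC addKr.
have pi2 : 2 * pi != 0 :> R by rewrite mulf_neq0 // gt_eqF // pi_gt0.
have [b0|b0] := leP 0 b.
  exists (acos a / (2 * pi)); apply: val_inj => /=.
  by rewrite mulrC divfK // ca sa ger0_norm.
exists (- acos a / (2 * pi)); apply: val_inj => /=.
by rewrite mulrC divfK // cosN sinN ca sa ltr0_norm // opprK.
Qed.

Lemma cisMn (R : realType) (x : R) n : cis (x * n%:R) = (cis x ^+ n)%g.
Proof.
elim: n => [|n IH]; first by rewrite mulr0 cis0.
by rewrite -natr1 mulrDr mulr1 cisD IH expgSr.
Qed.

Lemma char_ofD (R : realType) :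
  {morph @char_of R : x y / (x + y)%R >-> (x * y)%g}.
Proof.
move=> x y; apply: val_inj; apply/funext => m.
rewrite -[x]reprK -[y]reprK -pi_addr.
change (val (char_of (\pi_(RmodZ R)%qT (repr x + repr y))) m =
  (val (char_of (\pi_(RmodZ R)%qT (repr x))) m *
   val (char_of (\pi_(RmodZ R)%qT (repr y))) m)%g).
by rewrite !char_ofE mulrDl cisD.
Qed.

(** The group of integers is free on 1, so the value at 1 determines a
    character: this is why every character of the integers is some char_of. *)
Lemma characterE {R : realType} {chi : useq R} {k : R} :
  is_character chi -> cis k = chi 1 -> forall m, chi m = cis (k * m%:~R).
Proof.
move=> chiM chi1.
have chi0 : chi 0 = 1%g by apply: (mulgI (chi 0)); rewrite -chiM addr0 mulg1.
have chin n : chi n%:Z = cis (k * n%:R).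
  elim: n => [|n IH]; first by rewrite mulr0 cis0.
  by rewrite -natr1 mulrDr mulr1 cisD -IH chi1 -chiM -PoszD addn1.
case=> n; first exact: chin.
rewrite NegzE mulrNz mulrN cisN -chin; apply: (mulIg (chi n.+1)).
by rewrite -chiM addNr mulVg.
Qed.

(** Injectivity compares the values at 1 and uses that the integers are the
    kernel of cis; surjectivity takes an angle of chi 1. *)
Lemma char_of_bij (R : realType) : bijective (@char_of R).
Proof.
rewrite -setTT_bijective; split=> //.
- move=> x y _ _; rewrite -[x]reprK -[y]reprK => e.
  by apply/RmodZ_eqP/cis_eq; rewrite -[repr x]mulr1 -[repr y]mulr1 -!(char_ofE _ 1) e.
- move=> chi _; have [k k1] := cis_surj (val chi 1).
  exists (\pi_(RmodZ R)%qT k) => //; apply: val_inj; apply/funext => m.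
  by rewrite char_ofE (characterE (set_mem (valP chi)) k1).
Qed.

Lemma dualZ_expE (R : realType) (chi : dualZ R) n m :
  val (chi ^+ n)%g m = (val chi m ^+ n)%g.
Proof. by elim: n => // n IH; rewrite !expgS -IH. Qed.

(** If the n-th power of the character of k is trivial, its value at 1 gives
    cis (k n) = 1, so k n is an integer p and k = p / n is rational. Conversely
    the denominator of a rational q kills its character. *)
Lemma torsion_char_of (R : realType) (x : RmodZ R) :
  torsion (dualZ R) (char_of x) <-> @QmodZ R x.
Proof.
split=> [[n n0]|[q _ <-]].
  rewrite -[x]reprK => /(congr1 (fun chi => val chi 1)).
  rewrite dualZ_expE char_ofE mulr1 -cisMn => /cis_eq1/intrP[p pE].
  exists (p%:~R / n%:R) => //; congr (\pi _)%qT.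
  by rewrite fmorph_div /= ratr_int ratr_nat -pE mulfK // pnatr_eq0 -lt0n.
have d0 : (denq q)%:~R != 0 :> R by rewrite intr_eq0 denq_neq0.
exists `|denq q|%N; first by rewrite absz_gt0 denq_neq0.
apply: val_inj; apply/funext => m; rewrite dualZ_expE char_ofE -cisMn.
apply/cis_eq1; rewrite -[_%:R]/(_%:Z%:~R) absz_denq mulrAC [ratr q]/ratr.
by rewrite divfK // rpredM ?intr_int.
Qed.

Lemma phase_closure_int (R : realType) (p : int) :
  @phase_closure R (fun m => p%:~R * m%:~R).
Proof.
have Cn n : @phase_closure R (fun m => n%:R * m%:~R).
  elim: n => [|n IH].
    rewrite (_ : (fun _ => _) = (fun=> 1 + - 1)).
      exact: phase_add (phase_one _) (phase_opp (phase_one _)).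
    by apply/funext => m; rewrite mul0r subrr.
  rewrite (_ : (fun _ => _) = (fun m => n%:R * m%:~R + m%:~R)).
    exact: phase_add IH (phase_id _).
  by apply/funext => m; rewrite -natr1 mulrDl mul1r.
case: p => n; first exact: Cn.
rewrite (_ : (fun _ => _) = (fun m => - (n.+1%:R * m%:~R))).
  exact: phase_opp.
by apply/funext => m; rewrite NegzE mulrNz mulNr.
Qed.

(** The root operation with k = 0 divides an integral slope by the denominator:
    this is how the roots produce every rational wavenumber. *)
Lemma phase_closure_rat (R : realType) (a : rat) :
  @phase_closure R (fun m => ratr a * m%:~R).
Proof.
have d0 : (0 < `|denq a|)%N by rewrite absz_gt0 denq_neq0.
rewrite (_ : (fun _ => _) =
    (fun m => ((numq a)%:~R * m%:~R + 0%:R) / `|denq a|%N%:R)).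
  by apply: phase_root => //; exact: phase_closure_int.
by apply/funext => m; rewrite addr0 -[_%:R]/(_%:Z%:~R) absz_denq mulrAC.
Qed.

(** The phase closure contains every rational slope, so the wave space contains
    every spatial wave, and spatial waves are the characters of Q/Z. *)
Lemma wave_factorE (R : realType) (f : useq R) :
  wave_factor f <-> exists2 x, QmodZ x & f = val (char_of x).
Proof.
have sE a : spatial_wave R a = val (char_of (\pi_(RmodZ R)%qT (ratr a))).
  by apply/funext => m; rewrite char_ofE.
split=> [[_ [a ->]]|[_ [a _ <-] ->]].
  by exists (\pi_(RmodZ R)%qT (ratr a)); [exists a|exact: sE].
by split; last exists a; rewrite -sE //; exists (fun m => ratr a * m%:~R) => //;
  exact: phase_closure_rat.
Qed.

Fact wave_to_char_proof {R : realType} (f : Gwave R) :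
  val f \in @is_character R.
Proof.
by have /wave_factorE[x _ ->] := set_mem (valP f); exact: (valP (char_of x)).
Qed.

Definition wave_to_char {R : realType} (f : Gwave R) : dualZ R :=
  SigSub (wave_to_char_proof f).

Fact wave_to_torsion_proof {R : realType} (f : Gwave R) :
  wave_to_char f \in torsion (dualZ R).
Proof.
apply/mem_set; have /wave_factorE[x Qx fx] := set_mem (valP f).
have -> : wave_to_char f = char_of x by exact: val_inj.
exact/torsion_char_of.
Qed.

Definition wave_to_torsion {R : realType} (f : Gwave R) : torsionZ R :=
  SigSub (wave_to_torsion_proof f).

Fact wave_to_torsionM (R : realType) :
  {morph @wave_to_torsion R : f g / (f * g)%g}.
Proof. by move=> f g; do 2!apply: val_inj. Qed.

HB.instance Definition _ (R : realType) :=
  isMultiplicative.Build (Gwave R) (torsionZ R) (@wave_to_torsion R)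
    (@wave_to_torsionM R).

Lemma char_of_torsion {R : realType} {chi : dualZ R} :
  torsion (dualZ R) chi -> exists2 x, QmodZ x & char_of x = chi.
Proof.
have [g _ gK] := char_of_bij R; rewrite -[chi]gK => /torsion_char_of Qg.
by exists (g chi).
Qed.

(** The map does not change the underlying sequence, hence is injective; it is
    onto because a torsion character has a rational wavenumber. *)
Lemma wave_to_torsion_bij (R : realType) : bijective (@wave_to_torsion R).
Proof.
rewrite -setTT_bijective; split=> //.
  by move=> f g _ _ /(congr1 (val \o val)) e; exact: val_inj.
move=> t _; have [x Qx xt] := char_of_torsion (set_mem (valP t)).
have fP : val (val t) \in @wave_factor R.
  by apply/mem_set/wave_factorE; exists x => //; rewrite xt.
by exists (SigSub fP) => //; do 2!apply: val_inj.
Qed.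

Lemma QmodZ_zmod_closed (R : realType) : zmod_closed (mem (@QmodZ R)).
Proof.
split=> [|x y /set_mem[p _ <-] /set_mem[q _ <-]]; apply/mem_set.
  by exists 0 => //; rewrite rmorph0 pi_zeror.
by exists (p - q) => //; rewrite rmorphB pi_addr pi_oppr.
Qed.

(** A rational in the interval from x to x + e, for a representative x, projects
    into the ball of radius e, as the quotient distance is at most the distance
    between representatives. *)
Lemma QmodZ_dense (R : realType) : dense (@QmodZ R).
Proof.
move=> O [x Ox] Oop; have /nbhs_ballP[e /= e0 eO] := open_nbhs_nbhs (conj Oop Ox).
have xe : repr x < repr x + e by rewrite ltrDl.
have [q] := rat_in_itvoo xe.
rewrite in_itv /= => /andP[xq qe].
exists (\pi_(RmodZ R)%qT (ratr q)); split; last by exists q.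
apply: eO; rewrite ballEmdist /= RmodZ_mdistE -{1}[x]reprK.
by rewrite (le_lt_trans (RmodZ_dist_le _ _)) // distrC gtr0_norm ?subr_gt0 // ltrBlDl.
Qed.

Lemma QmodZ_countable (R : realType) : countable (@QmodZ R).
Proof. exact: card_le_trans (card_image_le _ _) (countableP _). Qed.

Theorem theorem4p5 (R : realType) :
  [/\ {morph @char_of R : x y / (x + y)%R >-> (x * y)%g},
      bijective (@char_of R),
      @char_of R @` @QmodZ R = torsion (dualZ R) &
      exists phi : {multiplicative Gwave R -> torsionZ R},
        [/\ bijective phi,
            forall (f : Gwave R) (m : int), val (val (phi f)) m = val f m &
            let W : set (RmodZ R) :=
              @char_of R @^-1` range (fun f => val (phi f)) in
            [/\ W = @QmodZ R, zmod_closed (mem W), dense W & countable W]]].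
Proof.
split; [exact: char_ofD|exact: char_of_bij| |].
  apply/seteqP; split=> [_ [x Qx <-]|chi]; first exact/torsion_char_of.
  by move=> /char_of_torsion.
exists (@wave_to_torsion R : {multiplicative _ -> _}).
split=> [|//|W]; first exact: wave_to_torsion_bij.
suff -> : W = @QmodZ R.
  split=> //; [exact: QmodZ_zmod_closed|exact: QmodZ_dense|exact: QmodZ_countable].
apply/seteqP; split=> x.
  by move=> [f _ fx]; apply/torsion_char_of; rewrite -fx; exact: set_mem (valP _).
move=> /torsion_char_of/mem_set xt.
have [g _ gK] := wave_to_torsion_bij R.
by exists (g (SigSub xt)) => //; exact: (congr1 val (gK (SigSub xt))).
Qed.
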